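(* Let $\Gamma$ be a finitely generated discrete group with finite symmetric generating set $Q$ and let $Z\subseteq\mathrm{Sub}(\Gamma)$ be a uniformly recurrent subgroup. The map $q:Z\rtimes\Gamma\to\mathcal{G}$, $q(L,\gamma)=(L,\gamma L)$ for $L\in Z$, $\gamma\in\Gamma$, is a continuous, open and surjective groupoid homomorphism. In particular, $\mathcal{G}$ is a quotient of the transformation groupoid $Z\rtimes\Gamma$.
   Context: Word length $l(\gamma)$ is taken with respect to $Q$. $\mathrm{Sub}(\Gamma)$ is the space of subgroups of $\Gamma$ with the topology of pointwise convergence of indicator functions, with $\Gamma$ acting by conjugation $\gamma.L=\gamma L\gamma^{-1}$. A uniformly recurrent subgroup (URS) is a nonempty closed $\Gamma$-invariant subset $Z\subseteq\mathrm{Sub}(\Gamma)$ on which every $\Gamma$-orbit is dense. For $L\le\Gamma$, the Schreier graph $S(L)$ is the rooted labeled graph with vertex set $\Gamma/L$, root $L$, and for each $\gamma L$ and $q\in Q$ an edge from $\gamma L$ to $q\gamma L$ labeled $q$; $B_N(S(L),L)$ is the ball of radius $N$ (path metric) around the root. Root-label isomorphism means graph isomorphism preserving roots and labels. Transformation groupoid $Z\rtimes\Gamma$: the space $Z\times\Gamma$ with product topology ($\Gamma$ discrete), $r(L,\gamma)=L$, $s(L,\gamma)=\gamma L\gamma^{-1}$, product $(L,\gamma)(\gamma L\gamma^{-1},\eta)=(L,\eta\gamma)$. The groupoid $\mathcal{G}$: as a set, $\mathcal{G}=\{(L,c): L\in Z,\ c\in\Gamma/L\}$, with $r(L,\gamma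 L)=L$, $s(L,\gamma L)=\gamma L\gamma^{-1}$, product $(L,\gamma L)(\gamma L\gamma^{-1},\eta\gamma L\gamma^{-1})=(L,\eta\gamma L)$, inverse $(L,\gamma L)^{-1}=(\gamma L\gamma^{-1},\gamma^{-1}\cdot\gamma L\gamma^{-1})$, and units $(L,L)$. Its topology has as basis the sets $U_{L,N,\gamma}=\{(L',\gamma L'): L'\in Z,\ (B_N(S(L'),L'),L')\text{ root-label isomorphic to }(B_N(S(L),L),L)\}$ for $L\in Z$, $N\in\mathbb{N}$, $\gamma\in\Gamma$ with $l(\gamma)\le N$. *)

(* Defs.v *)
(* Abstract (possibly infinite) discrete group given as a record
   with its axioms; subgroups are predicates Gamma -> Prop; cosets and
   Schreier-graph vertices are predicates, compared by Leibniz equality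
   (extensionality axioms are whitelisted). *)
From Stdlib Require Import List Arith.
Import ListNotations.

Record group := Group {
  carrier :> Type;
  mul : carrier -> carrier -> carrier;
  inv : carrier -> carrier;
  one : carrier;
  mulA : forall x y z, mul x (mul y z) = mul (mul x y) z;
  mul1g : forall x, mul one x = x;
  mulg1 : forall x, mul x one = x;
  mulVg : forall x, mul (inv x) x = one;
  mulgV : forall x, mul x (inv x) = one
}.

Arguments mul {g}.
Arguments inv {g}.
Arguments one {g}.

Section Defs.
Context {Gam : group}.

Definition gset := Gam -> Prop.

Definition is_subgroup (L : gset) : Prop :=
  L one /\ (forall x y, L x -> L y -> L (mul x y)) /\ (forall x, L x -> L (inv x)).

Definition conj (g : Gam) (L : gset) : gset := fun x => L (mul (mul (inv g) x) g).

Definition coset (g : Gam) (L : gset) : gset := fun x => exists l, L l /\ x = mul g l.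

Definition word_prod (w : list Gam) : Gam := fold_right mul one w.

Definition symmetric_set (Q : list Gam) : Prop := forall q, In q Q -> In (inv q) Q.

Definition generates (Q : list Gam) : Prop :=
  forall g, exists w, (forall q, In q w -> In q Q) /\ g = word_prod w.

Definition wordlen_le (Q : list Gam) (g : Gam) (N : nat) : Prop :=
  exists w, (forall q, In q w -> In q Q) /\ length w <= N /\ g = word_prod w.

Definition agree_on (F : list Gam) (L L' : gset) : Prop :=
  forall x, In x F -> (L x <-> L' x).

(* Z closed in Sub(Gamma) (pointwise convergence topology) *)
Definition closed_in_Sub (Z : gset -> Prop) : Prop :=
  forall L, is_subgroup L -> ~ Z L ->
    exists F, forall L', is_subgroup L' -> agree_on F L L' -> ~ Z L'.

Definition conj_invariant (Z : gset -> Prop) : Prop :=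
  forall g L, Z L -> Z (conj g L).

Definition orbits_dense (Z : gset -> Prop) : Prop :=
  forall L L0, Z L -> Z L0 -> forall F, exists g, agree_on F L0 (conj g L).

Definition is_URS (Z : gset -> Prop) : Prop :=
  (exists L, Z L) /\ (forall L, Z L -> is_subgroup L) /\ closed_in_Sub Z /\
  conj_invariant Z /\ orbits_dense Z.

Definition act (q : Gam) (C : gset) : gset := fun x => exists c, C c /\ x = mul q c.

Definition adjacent (Q : list Gam) (u v : gset) : Prop :=
  exists q, In q Q /\ (v = act q u \/ u = act q v).

Fixpoint in_ball (Q : list Gam) (L : gset) (n : nat) (v : gset) : Prop :=
  match n with
  | 0 => v = coset one L
  | S n' => in_ball Q L n' v \/ exists u, in_ball Q L n' u /\ adjacent Q u v
  end.

Definition ball_iso (Q : list Gam) (N : nat) (L L' : gset) : Prop :=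
  exists (phi psi : gset -> gset),
    (forall v, in_ball Q L N v -> in_ball Q L' N (phi v) /\ psi (phi v) = v) /\
    (forall v', in_ball Q L' N v' -> in_ball Q L N (psi v') /\ phi (psi v') = v') /\
    phi (coset one L) = coset one L' /\
    (forall u v q, in_ball Q L N u -> in_ball Q L N v -> In q Q ->
       (act q u = v <-> act q (phi u) = phi v)).

Definition inZG (Z : gset -> Prop) (x : gset * Gam) : Prop := Z (fst x).
Definition rZG (x : gset * Gam) : gset := fst x.
Definition sZG (x : gset * Gam) : gset := conj (snd x) (fst x).
Definition composableZG (x y : gset * Gam) : Prop := sZG x = fst y.
Definition prodZG (x y : gset * Gam) : gset * Gam := (fst x, mul (snd y) (snd x)).

Definition openZG (Z : gset -> Prop) (S : gset * Gam -> Prop) : Prop :=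
  (forall x, S x -> inZG Z x) /\
  (forall x, S x -> exists F, forall L', Z L' -> agree_on F (fst x) L' -> S (L', snd x)).

Definition inG (Z : gset -> Prop) (x : gset * gset) : Prop :=
  Z (fst x) /\ exists g, snd x = coset g (fst x).
Definition rG (x : gset * gset) : gset := fst x.
(* s(L, gL) = g L g^{-1}  (as a relation: independent of representative) *)
Definition sG_rel (x : gset * gset) (M : gset) : Prop :=
  exists g, snd x = coset g (fst x) /\ M = conj g (fst x).
Definition prodG_rel (x y z : gset * gset) : Prop :=
  exists L g h, x = (L, coset g L) /\ y = (conj g L, coset h (conj g L)) /\
                z = (L, coset (mul h g) L).

Definition basisG (Q : list Gam) (Z : gset -> Prop) (L0 : gset) (N : nat) (g : Gam)
    (x : gset * gset) : Prop :=
  Z (fst x) /\ snd x = coset g (fst x) /\ ball_iso Q N (fst x) L0.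

Definition openG (Q : list Gam) (Z : gset -> Prop) (S : gset * gset -> Prop) : Prop :=
  (forall x, S x -> inG Z x) /\
  (forall x, S x -> exists L0 N g, Z L0 /\ wordlen_le Q g N /\
      basisG Q Z L0 N g x /\ (forall y, basisG Q Z L0 N g y -> S y)).

Definition qmap (x : gset * Gam) : gset * gset := (fst x, coset (snd x) (fst x)).

Definition groupoid_hom_q (Z : gset -> Prop) : Prop :=
  (forall x, inZG Z x -> inG Z (qmap x)) /\
  (forall x, inZG Z x -> rG (qmap x) = rZG x /\ sG_rel (qmap x) (sZG x)) /\
  (forall x y, inZG Z x -> inZG Z y -> composableZG x y ->
     prodG_rel (qmap x) (qmap y) (qmap (prodZG x y))).

Definition continuous_q (Q : list Gam) (Z : gset -> Prop) : Prop :=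
  forall S, openG Q Z S -> openZG Z (fun x => inZG Z x /\ S (qmap x)).

Definition open_q (Q : list Gam) (Z : gset -> Prop) : Prop :=
  forall T, openZG Z T -> openG Q Z (fun y => exists x, T x /\ y = qmap x).

Definition surjective_q (Z : gset -> Prop) : Prop :=
  forall y, inG Z y -> exists x, inZG Z x /\ qmap x = y.

End Defs.

(* Main.v *)
(* A root-label isomorphism between the balls of radius N of S(L) and S(L')
   transports the vertex wL to wL' for every word w of length at most N, so L
   and L' contain the same such words.  Conversely, if L and L' contain the same
   words of length at most 2N+1, then wL |-> wL' is a well-defined root-label
   isomorphism of the N-balls.  Hence the basic open sets of G are, up to the
   coset condition gL = g'L, given by finitely many membership conditions:
   their preimages under q are open (continuity), and every membership
   neighbourhood of L in Z x| Gamma contains a Schreier-ball neighbourhood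
   (openness). *)

Require Import Defs.
From Stdlib Require Import List Lia FunctionalExtensionality PropExtensionality.
Import ListNotations.

Section Cosets.
Context {G : group}.

Lemma gset_ext (P R : @gset G) : (forall x, P x <-> R x) -> P = R.
Proof.
  intro H. apply functional_extensionality; intro x.
  apply propositional_extensionality, H.
Qed.

Lemma invgK (x : G) : inv (inv x) = x.
Proof.
  rewrite <- (mulg1 _ (inv (inv x))), <- (mulVg _ x), mulA, mulVg, mul1g.
  reflexivity.
Qed.

Lemma invMg (x y : G) : inv (mul x y) = mul (inv y) (inv x).
Proof.
  assert (Hxy : mul (mul x y) (mul (inv y) (inv x)) = one).
  { rewrite <- mulA, (mulA _ y), mulgV, mul1g, mulgV. reflexivity. }
  rewrite <- (mulg1 _ (inv (mul x y))), <- Hxy, mulA, mulVg, mul1g.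
  reflexivity.
Qed.

Lemma invg1 : @inv G one = one.
Proof. rewrite <- (mulg1 _ (inv one)). apply mulVg. Qed.

Lemma word_prod_app (u v : list G) :
  word_prod (u ++ v) = mul (word_prod u) (word_prod v).
Proof.
  induction u as [|a u IH]; simpl.
  - now rewrite mul1g.
  - now rewrite IH, mulA.
Qed.

Lemma word_prod_rev_inv (w : list G) : word_prod (rev (map inv w)) = inv (word_prod w).
Proof.
  induction w as [|a w IH]; simpl.
  - now rewrite invg1.
  - rewrite word_prod_app, IH, invMg. simpl. now rewrite mulg1.
Qed.

Lemma act_coset (q g : G) (L : gset) : act q (coset g L) = coset (mul q g) L.
Proof.
  apply gset_ext; intro x; split.
  - intros [c [[l [Hl ->]] ->]]. exists l. split; [exact Hl | apply mulA].
  - intros [l [Hl ->]]. exists (mul g l). split.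
    + now exists l.
    + symmetry; apply mulA.
Qed.

Lemma act_invK (q : G) (v : gset) : act (inv q) (act q v) = v.
Proof.
  apply gset_ext; intro x; split.
  - intros [c [[d [Hd ->]] ->]]. now rewrite mulA, mulVg, mul1g.
  - intro Hx. exists (mul q x). split.
    + now exists x.
    + now rewrite mulA, mulVg, mul1g.
Qed.

Lemma coset_eq (L : @gset G) (a b : G) :
  is_subgroup L -> coset a L = coset b L <-> L (mul (inv b) a).
Proof.
  intros [H1 [HM HI]]. split.
  - intro E.
    assert (Ha : coset a L a) by (exists one; rewrite mulg1; auto).
    rewrite E in Ha. destruct Ha as [l [Hl ->]].
    now rewrite mulA, mulVg, mul1g.
  - intro Hab. apply gset_ext; intro x; split.
    + intros [l [Hl ->]]. exists (mul (mul (inv b) a) l). split; [auto|].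
      now rewrite !mulA, mulgV, mul1g.
    + intros [l [Hl ->]]. exists (mul (inv (mul (inv b) a)) l). split; [auto|].
      now rewrite invMg, invgK, !mulA, mulgV, mul1g.
Qed.

Lemma coset_eq_one (L : @gset G) (a : G) :
  is_subgroup L -> coset a L = coset one L <-> L a.
Proof. intro HL. rewrite coset_eq, invg1, mul1g by exact HL. reflexivity. Qed.

End Cosets.

Section SchreierBalls.
Context {G : group} (Q : list G).

Lemma in_ball_le (L : gset) n m v : n <= m -> in_ball Q L n v -> in_ball Q L m v.
Proof. induction 1; simpl; auto. Qed.

Lemma in_ball_coset_word (L : gset) (w : list G) n :
  incl w Q -> length w <= n -> in_ball Q L n (coset (word_prod w) L).
Proof.
  revert n. induction w as [|q w IH]; intros n Hw Hn.
  - apply (in_ball_le _ 0); [lia | reflexivity].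
  - destruct n as [|n]; simpl in Hn; [lia|].
    apply incl_cons_inv in Hw as [Hq Hw].
    right. exists (coset (word_prod w) L). split.
    + apply IH; [exact Hw | lia].
    + exists q. split; [exact Hq|]. left. now rewrite act_coset.
Qed.

Lemma in_ball_word (L : gset) n v : symmetric_set Q -> in_ball Q L n v ->
  exists w, incl w Q /\ length w <= n /\ v = coset (word_prod w) L.
Proof.
  intro HQ. revert v. induction n as [|n IH]; intros v Hv; simpl in Hv.
  - exists []. split; [apply incl_nil_l | split; [simpl; lia | exact Hv]].
  - destruct Hv as [Hv | [u [Hu [q [Hq [Ev | Eu]]]]]].
    + destruct (IH v Hv) as [w [Hw [Hn Ev]]]. exists w. repeat split; auto.
    + destruct (IH u Hu) as [w [Hw [Hn ->]]]. exists (q :: w). repeat split.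
      * now apply incl_cons.
      * simpl; lia.
      * now rewrite Ev, act_coset.
    + destruct (IH u Hu) as [w [Hw [Hn Ew]]]. exists (inv q :: w). repeat split.
      * apply incl_cons; auto.
      * simpl; lia.
      * now rewrite <- (act_invK q v), <- Eu, Ew, act_coset.
Qed.

Lemma ball_iso_refl N (A : gset) : ball_iso Q N A A.
Proof. exists (fun v => v), (fun v => v). repeat split; auto; tauto. Qed.

Lemma ball_iso_trans N (A B C : gset) :
  ball_iso Q N A B -> ball_iso Q N B C -> ball_iso Q N A C.
Proof.
  intros [p1 [s1 [H1 [H2 [H3 H4]]]]] [p2 [s2 [K1 [K2 [K3 K4]]]]].
  exists (fun v => p2 (p1 v)), (fun v => s1 (s2 v)). split; [|split; [|split]].
  - intros v Hv. destruct (H1 v Hv) as [Hb E1]. destruct (K1 _ Hb) as [Hc E2].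
    split; [exact Hc | now rewrite E2].
  - intros v Hv. destruct (K2 v Hv) as [Hb E1]. destruct (H2 _ Hb) as [Ha E2].
    split; [exact Ha | now rewrite E2].
  - now rewrite H3.
  - intros u v q Hu Hv Hq. rewrite (H4 u v q Hu Hv Hq).
    apply K4; [apply H1; assumption .. | exact Hq].
Qed.

Definition agree_upto (M : nat) (A B : @gset G) : Prop :=
  forall w, incl w Q -> length w <= M -> (A (word_prod w) <-> B (word_prod w)).

Lemma agree_upto_le M M' A B : M' <= M -> agree_upto M A B -> agree_upto M' A B.
Proof. intros HM Hag w Hw Hn. apply Hag; [exact Hw | lia]. Qed.

Lemma agree_upto_sym M A B : agree_upto M A B -> agree_upto M B A.
Proof. intros Hag w Hw Hn. symmetry. now apply Hag. Qed.

Lemma ball_iso_map_coset N (A B : gset) phi :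
  phi (coset one A) = coset one B ->
  (forall u v q, in_ball Q A N u -> in_ball Q A N v -> In q Q ->
     (act q u = v <-> act q (phi u) = phi v)) ->
  forall w, incl w Q -> length w <= N ->
  phi (coset (word_prod w) A) = coset (word_prod w) B.
Proof.
  intros Hroot Hedge. induction w as [|q w IH]; intros Hw Hn; simpl.
  - exact Hroot.
  - simpl in Hn. apply incl_cons_inv in Hw as [Hq Hw].
    rewrite <- !act_coset, <- IH by (auto; lia). symmetry.
    apply (Hedge (coset (word_prod w) A)); [| | exact Hq | reflexivity].
    + apply in_ball_coset_word; [exact Hw | lia].
    + rewrite act_coset. apply (in_ball_coset_word _ (q :: w)); [|simpl; lia].
      now apply incl_cons.
Qed.

Lemma ball_iso_agree_upto N (A B : gset) :
  is_subgroup A -> is_subgroup B -> ball_iso Q N A B -> agree_upto N A B.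
Proof.
  intros HA HB [phi [psi [Hphi [_ [Hroot Hedge]]]]] w Hw Hn.
  pose proof (ball_iso_map_coset N A B phi Hroot Hedge w Hw Hn) as Ew.
  rewrite <- (coset_eq_one A), <- (coset_eq_one B) by assumption. split.
  - intro EA. now rewrite <- Ew, EA.
  - intro EB. rewrite <- Ew, <- Hroot in EB.
    assert (Hr : in_ball Q A N (coset one A))
      by (apply (in_ball_coset_word A []); [apply incl_nil_l | simpl; lia]).
    destruct (Hphi _ Hr) as [_ Er].
    destruct (Hphi _ (in_ball_coset_word A w N Hw Hn)) as [_ Ev].
    now rewrite <- Ev, EB, Er.
Qed.

(* As Q is symmetric, v^{-1} u is a word over Q of length |u| + |v|. *)
Lemma agree_upto_coset_eq m n (A B : gset) (u v : list G) :
  symmetric_set Q -> is_subgroup A -> is_subgroup B -> agree_upto (m + n) A B ->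
  incl u Q -> length u <= m -> incl v Q -> length v <= n ->
  (coset (word_prod u) A = coset (word_prod v) A <->
   coset (word_prod u) B = coset (word_prod v) B).
Proof.
  intros HQ HA HB Hag Hu Hm Hv Hn.
  rewrite !coset_eq, <- word_prod_rev_inv, <- word_prod_app by assumption.
  apply Hag.
  - apply incl_app; [|exact Hu].
    intros x Hx. apply in_rev, in_map_iff in Hx as [y [<- Hy]]. now apply HQ, Hv.
  - rewrite length_app, length_rev, length_map. lia.
Qed.

(* On the N-ball this is the single coset wB, because A and B agree on
   words of length 2N. *)
Definition ball_map (N : nat) (A B : @gset G) (v : gset) : gset :=
  fun x => exists w, incl w Q /\ length w <= N /\ v = coset (word_prod w) A /\
                     coset (word_prod w) B x.

Lemma ball_map_coset N (A B : gset) w :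
  symmetric_set Q -> is_subgroup A -> is_subgroup B -> agree_upto (N + N) A B ->
  incl w Q -> length w <= N ->
  ball_map N A B (coset (word_prod w) A) = coset (word_prod w) B.
Proof.
  intros HQ HA HB Hag Hw Hn. apply gset_ext; intro x; split.
  - intros [w' [Hw' [Hn' [E Hx]]]].
    apply (agree_upto_coset_eq N N A B w w' HQ HA HB Hag Hw Hn Hw' Hn') in E.
    now rewrite E.
  - intro Hx. now exists w.
Qed.

Lemma agree_upto_ball_iso N (A B : gset) :
  symmetric_set Q -> is_subgroup A -> is_subgroup B ->
  agree_upto (S (N + N)) A B -> ball_iso Q N A B.
Proof.
  intros HQ HA HB Hag.
  assert (HAB : agree_upto (N + N) A B) by (apply (agree_upto_le (S (N + N))); auto).
  pose proof (agree_upto_sym _ _ _ HAB) as HBA.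
  exists (ball_map N A B), (ball_map N B A). split; [|split; [|split]].
  - intros v Hv. destruct (in_ball_word A N v HQ Hv) as [w [Hw [Hn ->]]].
    rewrite !ball_map_coset by assumption.
    split; [now apply in_ball_coset_word | reflexivity].
  - intros v Hv. destruct (in_ball_word B N v HQ Hv) as [w [Hw [Hn ->]]].
    rewrite !ball_map_coset by assumption.
    split; [now apply in_ball_coset_word | reflexivity].
  - apply (ball_map_coset N A B []); auto; [apply incl_nil_l | simpl; lia].
  - intros u v q Hu Hv Hq.
    destruct (in_ball_word A N u HQ Hu) as [wu [Hwu [Hnu ->]]].
    destruct (in_ball_word A N v HQ Hv) as [wv [Hwv [Hnv ->]]].
    rewrite !ball_map_coset, !act_coset by assumption.
    apply (agree_upto_coset_eq (S N) N A B (q :: wu) wv); try assumption.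
    + now apply incl_cons.
    + simpl; lia.
Qed.

Fixpoint words (n : nat) : list (list G) :=
  match n with
  | 0 => [[]]
  | S n => [] :: flat_map (fun q => map (cons q) (words n)) Q
  end.

Lemma in_words n w : incl w Q -> length w <= n -> In w (words n).
Proof.
  revert w. induction n as [|n IH]; intros [|q w] Hw Hn; simpl in *; auto; try lia.
  right. apply incl_cons_inv in Hw as [Hq Hw].
  apply in_flat_map. exists q. split; [exact Hq|].
  apply in_map, IH; [exact Hw | lia].
Qed.

Lemma agree_on_words M (A B : gset) F :
  incl (map word_prod (words M)) F -> agree_on F A B -> agree_upto M A B.
Proof. intros HF Hag w Hw Hn. apply Hag, HF, in_map, in_words; assumption. Qed.

Lemma wordlen_bound : generates Q -> forall F : list G,
  exists N, forall f, In f F -> wordlen_le Q f N.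
Proof.
  intros HG F. induction F as [|f F [N IH]].
  - exists 0. intros f [].
  - destruct (HG f) as [w [Hw Ef]]. exists (max N (length w)). intros x [<- | Hx].
    + exists w. repeat split; auto; lia.
    + destruct (IH x Hx) as [w' [Hw' [Hn' E']]]. exists w'. repeat split; auto; lia.
Qed.

End SchreierBalls.

Section QuotientMap.
Context {G : group} (Q : list G) (Z : @gset G -> Prop).
Hypothesis Z_subgroups : forall L, Z L -> is_subgroup L.

Lemma qmap_continuous : symmetric_set Q -> continuous_q Q Z.
Proof.
  intros HQ U [_ HU]. split; [now intros x [HZx _]|].
  intros [L g0] [HL HUx].
  destruct (HU _ HUx) as [L0 [N [g [_ [_ [[_ [Eg Hiso]] Hbasis]]]]]]; simpl in *.
  exists (mul (inv g) g0 :: map word_prod (words Q (S (N + N)))).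
  intros L' HL' Hag. split; [exact HL'|]. apply Hbasis.
  split; [exact HL' | split]; simpl.
  - apply coset_eq; [now apply Z_subgroups|].
    apply (Hag _ (or_introl eq_refl)), coset_eq; [now apply Z_subgroups | exact Eg].
  - apply (ball_iso_trans Q N L' L L0); [|exact Hiso].
    apply agree_upto_ball_iso; auto.
    apply agree_upto_sym, (agree_on_words Q _ _ _ _ (incl_tl _ (incl_refl _)) Hag).
Qed.

Lemma qmap_open : generates Q -> open_q Q Z.
Proof.
  intros HG T [HTZ HT]. split.
  - intros y [x [Hx ->]]. split; [exact (HTZ _ Hx) | now exists (snd x)].
  - intros y [[L g] [HTx ->]]. destruct (HT _ HTx) as [F HF]; simpl in HF.
    destruct (wordlen_bound Q HG F) as [NF HNF].
    destruct (HG g) as [w [Hw Eg]].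
    assert (HL : Z L) by exact (HTZ _ HTx).
    exists L, (max NF (length w)), g. split; [exact HL | split; [|split]].
    + exists w. split; [exact Hw | split; [lia | exact Eg]].
    + split; [exact HL | split; [reflexivity | apply ball_iso_refl]].
    + intros [L' c] [HL' [Ec Hiso]]; simpl in *. exists (L', g). split.
      * apply HF; [exact HL'|]. intros f Hf.
        destruct (HNF f Hf) as [wf [Hwf [Hn ->]]].
        symmetry. apply (ball_iso_agree_upto Q (max NF (length w)) L' L); auto. lia.
      * unfold qmap; simpl. now rewrite Ec.
Qed.

End QuotientMap.

Lemma qmap_surjective {G : group} (Z : @gset G -> Prop) : surjective_q Z.
Proof. intros [L c] [HL [g Ec]]. exists (L, g). simpl in *. now rewrite Ec. Qed.

Lemma qmap_groupoid_hom {G : group} (Z : @gset G -> Prop) : groupoid_hom_q Z.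
Proof.
  split; [|split].
  - intros x Hx. split; [exact Hx | now exists (snd x)].
  - intros x Hx. split; [reflexivity | now exists (snd x)].
  - intros [L g] [L' h] _ _ Hcomp. unfold composableZG, sZG in Hcomp; simpl in Hcomp.
    subst L'. now exists L, g, h.
Qed.

Theorem proposition4p1 (Gam : group) (Q : list Gam) (Z : @gset Gam -> Prop) :
  symmetric_set Q -> generates Q -> is_URS Z ->
  continuous_q Q Z /\ open_q Q Z /\ surjective_q Z /\ groupoid_hom_q Z.
Proof.
  intros HQ HG [_ [HZ _]].
  split; [|split; [|split]].
  - exact (qmap_continuous Q Z HZ HQ).
  - exact (qmap_open Q Z HZ HG).
  - apply qmap_surjective.
  - apply qmap_groupoid_hom.
Qed.
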